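(* For any real $M, D > 0$ and any integer $N \ge 1$, the set of minimax optimal fixed-step first-order methods is $$\mathcal{W}_\star^{M,D,N} = W(\mathcal{P}^N) = \{W(\lambda) : \lambda\in\mathcal{P}^N\}.$$
   Context: Matrices. $\mathbb{L}^N$ is the set of real lower triangular $N\times N$ matrices $W$, with rows indexed $1,\dots,N$ and columns indexed $0,\dots,N-1$; so the (possibly nonzero) entries are $W_{n,j}$ with $0\le j<n\le N$. Empty sums are $0$. Problem class. $\mathtt{P}_{M,D}$ is the set of all pairs $(f,x_0)$, over all dimensions $d$, with $f:\mathbb{R}^d\to\mathbb{R}$ convex and $M$-Lipschitz (Euclidean norm), $x_0\in\mathbb{R}^d$, such that $f$ attains its minimum at some $x_\star$ with $\|x_0-x_\star\|\le D$. Methods. $W\in\mathbb{L}^N$ parameterizes the fixed-step first-order method $x_n = x_0-\sum_{i=0}^{n-1}W_{n,i}g_i$, $n=1,\dots,N$, where $g_i\in\partial f(x_i)$ are arbitrary subgradients. Its worst-case performance is $$p_\star(W)=\max\, \{f(x_N)-f(x_\star)\},$$ the maximum being over all $(f,x_0)\in\mathtt{P}_{M,D}$ and all choices of subgradients $g_i\in\partial f(x_i)$ along the trajectory. It is known that the minimax optimal value of this worst-case final objective gap, over all $N$-step methods with $x_n\in x_0-\mathrm{span}\{g_0,\dots,g_{n-1}\}$, is $\frac{MD}{\sqrt{N+1}}$, and it is attained by some $W\in\mathbb{L}^N$. The set of optimal fixed-step methods is $$\mathcal{W}_\star^{M,D,N}=\Big\{W\in\mathbb{L}^N : p_\star(W)=\tfrac{MD}{\sqrt{N+1}}\Big\}.$$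 The polyhedron. For real arrays $\lambda=(\lambda_{i,j})_{0\le i<j\le N}$, $$\mathcal{P}^N=\Big\{\lambda : \lambda_{i,j}\ge 0 \text{ for all } i<j,\ \ \sum_{i=j+1}^N\lambda_{j,i}-\sum_{i=0}^{j-1}\lambda_{i,j}=\frac{1}{N+1},\ j=0,\dots,N-1\Big\}.$$ The map $W(\cdot)$. For an array $\lambda$ with $\Lambda_n := \frac{1}{N+1}+\sum_{i=0}^{n-1}\lambda_{i,n}>0$ for $n=1,\dots,N$, $W(\lambda)\in\mathbb{L}^N$ is defined recursively (in $n$) by $$W_{n,j}=\frac{1}{\Lambda_n}\Big(\frac{D}{M(N+1)^{3/2}}+\sum_{i=j+1}^{n-1}\lambda_{i,n}W_{i,j}\Big),\qquad 0\le j<n\le N.$$ *)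

(* Defs.v *)
From mathcomp Require Import all_boot all_order all_algebra.
From mathcomp Require Import all_classical all_reals all_analysis.
Set Implicit Arguments.
Unset Strict Implicit.
Unset Printing Implicit Defensive.
Import Order.TTheory GRing.Theory Num.Theory.
Local Open Scope classical_set_scope.
Local Open Scope ring_scope.

(* The library's norm on ['rV[R]_d] is the sup norm, hence these definitions. *)
Definition dot (R : realType) (d : nat) (x y : 'rV[R]_d) : R :=
  \sum_(k < d) x 0 k * y 0 k.

Definition norm2 (R : realType) (d : nat) (x : 'rV[R]_d) : R :=
  Num.sqrt (dot x x).

Definition subgradient (R : realType) (d : nat) (f : 'rV[R]_d -> R)
    (x : 'rV[R]_d) : set 'rV[R]_d :=
  [set g | forall y, f x + dot g (y - x) <= f y].

Definition minimizer (R : realType) (d : nat) (f : 'rV[R]_d -> R)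
    (xs : 'rV[R]_d) : Prop :=
  forall y, f xs <= f y.

Definition problem_class (R : realType) (M D : R) (d : nat)
    (f : 'rV[R]_d -> R) (x0 : 'rV[R]_d) : Prop :=
  [/\ @convex_function R 'rV[R]_d [set: convex_lmodType 'rV[R]_d] f,
      forall x y, `|f x - f y| <= M * norm2 (x - y)
    & exists xs, minimizer f xs /\ norm2 (x0 - xs) <= D].

(* A method is a matrix [W : 'M[R]_N].  Its rows are shifted by one: the entry
   W_{n,j}, 1 <= n <= N and 0 <= j < N, is [W r j] with n = r + 1.
   Hence j < n reads [j <= r], the mathcomp notion [is_trig_mx] of lower
   triangular matrix is exactly W_{n,j} = 0 for j >= n, and the index n seen in
   {0, ..., N} is [lift ord0 r]. *)

Definition trajectory (R : realType) (N : nat) (W : 'M[R]_N) (d : nat)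
    (f : 'rV[R]_d -> R) (x : 'I_N.+1 -> 'rV[R]_d) (g : 'I_N -> 'rV[R]_d) :
    Prop :=
  (forall i : 'I_N, subgradient f (x (widen_ord (leqnSn N) i)) (g i)) /\
  (forall r : 'I_N,
     x (lift ord0 r) = x ord0 - \sum_(i < N | (i <= r)%N) W r i *: g i).

Definition final_gaps (R : realType) (M D : R) (N : nat) (W : 'M[R]_N) :
    set R :=
  [set v | exists (d : nat) (f : 'rV[R]_d -> R) (x : 'I_N.+1 -> 'rV[R]_d)
             (g : 'I_N -> 'rV[R]_d) (xs : 'rV[R]_d),
     [/\ problem_class M D f (x ord0), trajectory W f x g, minimizer f xs
       & v = f (x ord_max) - f xs]].

(* p_star(W) = v, where p_star(W) is a maximum, not only a supremum. *)
Definition worst_case (R : realType) (M D : R) (N : nat) (W : 'M[R]_N) (v : R) :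
    Prop :=
  final_gaps M D W v /\ ubound (final_gaps M D W) v.

Definition optimal_methods (R : realType) (M D : R) (N : nat) : set 'M[R]_N :=
  [set W | is_trig_mx W /\ worst_case M D W (M * D / Num.sqrt N.+1%:R)].

Arguments optimal_methods {R} M D N _.

(* The array (lambda_{i,j})_{0 <= i < j <= N} is a matrix indexed by
   {0, ..., N} whose other entries are set to 0. *)
Definition polyhedron (R : realType) (N : nat) : set 'M[R]_N.+1 :=
  [set lam | [/\ forall i j : 'I_N.+1, (j <= i)%N -> lam i j = 0,
                 forall i j : 'I_N.+1, (i < j)%N -> 0 <= lam i j
               & forall j : 'I_N.+1, (j < N)%N ->
                   \sum_(i < N.+1 | (j < i)%N) lam j i
                     - \sum_(i < N.+1 | (i < j)%N) lam i j = N.+1%:R^-1]].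

Arguments polyhedron R N _ : clear implicits.

Definition Lam (R : realType) (N : nat) (lam : 'M[R]_N.+1) (n : 'I_N.+1) : R :=
  N.+1%:R^-1 + \sum_(i < N.+1 | (i < n)%N) lam i n.

(* The right-hand side of the recursion for W_{n,j}, n = r + 1.  The summation
   index is i = k + 1, so that j + 1 <= i <= n - 1 reads [j <= k < r]. *)
Definition W_rhs (R : realType) (M D : R) (N : nat) (lam : 'M[R]_N.+1)
    (W : 'M[R]_N) (r j : 'I_N) : R :=
  (Lam lam (lift ord0 r))^-1 *
  (D / (M * N.+1%:R `^ (3 / 2))
   + \sum_(k < N | (j <= k < r)%N) lam (lift ord0 k) (lift ord0 r) * W k j).

(* The row [r] depends on the rows before it only, so it is final after [r + 1]
   iterations; see [W_ofE] for the resulting recursion. *)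
Definition W_of (R : realType) (M D : R) (N : nat) (lam : 'M[R]_N.+1) :
    'M[R]_N :=
  iter N (fun W => \matrix_(r, j) if (j <= r)%N then W_rhs M D lam W r j else 0)
       0.

Lemma W_of_trig (R : realType) (M D : R) (N : nat) (lam : 'M[R]_N.+1) :
  is_trig_mx (W_of M D lam).
Proof.
apply/is_trig_mxP => r j rj; rewrite /W_of.
case: N lam r j rj => [|N] lam r j rj; first by case: r rj.
by rewrite iterS mxE leqNgt rj.
Qed.

Lemma W_ofE (R : realType) (M D : R) (N : nat) (lam : 'M[R]_N.+1)
    (r j : 'I_N) : (j <= r)%N ->
  W_of M D lam r j = W_rhs M D lam (W_of M D lam) r j.
Proof.
move=> jr.
pose F (W : 'M[R]_N) : 'M[R]_N :=
  \matrix_(r, j) if (j <= r)%N then W_rhs M D lam W r j else 0.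
have stab m (s k : 'I_N) : (s < m)%N -> iter m.+1 F 0 s k = iter m F 0 s k.
  elim: m s k => [//|m IH] s k sm.
  rewrite iterS [in RHS]iterS !mxE; case: ifP => // ks.
  rewrite /W_rhs; congr (_ * (_ + _)); apply: eq_bigr => i /andP[_ si].
  by rewrite IH// (leq_trans si).
by rewrite -[LHS](stab N)// iterS mxE jr.
Qed.

Lemma Lam_gt0 (R : realType) (N : nat) (lam : 'M[R]_N.+1) (n : 'I_N.+1) :
  polyhedron R N lam -> 0 < Lam lam n.
Proof.
move=> [_ lam0 _]; rewrite ltr_pwDl ?invr_gt0 ?ltr0n//.
by apply: sumr_ge0 => i; exact: lam0.
Qed.

(* Main.v *)
Require Import Defs.
From mathcomp Require Import all_boot all_order all_algebra.
From mathcomp Require Import all_classical all_reals all_analysis.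
From mathcomp Require Import ring lra.
Set Implicit Arguments.
Unset Strict Implicit.
Unset Printing Implicit Defensive.
Import Order.TTheory GRing.Theory Num.Theory.
Local Open Scope classical_set_scope.
Local Open Scope ring_scope.

(** Write [v = M D / sqrt (N+1)] and [c = D / (M (N+1)^(3/2))].

    If [W = W(lambda)], the subgradient inequalities between [x_i] and [x_j]
    weighted by [lambda_{i,j}], and those between [x_star] and [x_j] weighted by
    [1/(N+1)], add up to
    [f(x_N) - f_star <=
     sum_j <g_j, (x_0 - x_star)/(N+1) - c sum_{k<j} g_k>],
    which is at most [v] by completing a square.  The bound is attained by
    [f = max (-v) (M max_k x_k)] on [R^(N+1)].

    Conversely, let [W] be optimal.  Its entries below the diagonal are positive,
    since otherwise a resisting oracle needs only [N] dimensions and the gap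
    reaches [M D / sqrt N].  The conditions [lambda >= 0], the flow equations
    and [W = W(lambda)] are linear in [lambda]; were they infeasible, a Farkas
    certificate [(y, u)] would give a first-order perturbation of the instance
    above, with [<g_n, g_j> = - eps y_{n,j}] and [f(x_i) = eps u_i], whose
    gap exceeds [v].  Positivity of [W] makes the interpolation inequalities
    that are not covered by the certificate strict at [eps = 0]. *)

(** * Farkas' lemma, Euclidean geometry, convexity *)

(* Bartl's induction: if the constraints other than [a t0] do not suffice, that
   is, if some [x0] satisfies them with [c x0 > 0], the induction hypothesis is
   applied to the functionals composed with the projection onto the kernel of
   [a t0] along [x0]. *)
Lemma farkas (R : realType) (V : lmodType R) (T : eqType) (s : seq T)
    (a : T -> V -> R) (c : V -> R) :
  uniq s -> (forall t, scalar (a t)) -> scalar c ->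
  (forall x, {in s, forall t, a t x <= 0} -> c x <= 0) ->
  exists2 l : T -> R, forall t, 0 <= l t &
    forall x, c x = \sum_(t <- s) l t * a t x.
Proof.
elim: s a c => [|t0 s IH] a c /= => [_ _ lc ac|/andP[t0s us] la lc ac].
  exists (fun=> 0) => // x; rewrite big_nil.
  have c0 : c 0 = 0 by have := lc (-1) 0 0; rewrite scaler0 addr0; lra.
  apply/eqP; rewrite eq_le ac//=.
  by have := ac (- x) (fun t => ltac:(by [])); have := lc (-1) x 0;
    rewrite scaleN1r addr0 c0; lra.
have [sc|/existsNP[x0 /not_implyP[ax0 /negP]]] :=
    pselect (forall x, {in s, forall t, a t x <= 0} -> c x <= 0).
  have [l l0 lE] := IH a c us la lc sc.
  exists (fun t => if t == t0 then 0 else l t) => [t|x]; first by case: ifP.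
  rewrite big_cons eqxx mul0r add0r lE; apply: eq_big_seq => t ts.
  by case: eqP ts t0s => // -> ->.
rewrite -ltNge => cx0.
have a0x0 : 0 < a t0 x0.
  rewrite ltNge; apply/negP => a0; move: cx0; rewrite ltNge => /negP; apply.
  by apply: ac => t; rewrite inE => /predU1P[->//|]; exact: ax0.
pose x1 := (a t0 x0)^-1 *: x0.
have sZ (f : V -> R) (k : R) x : scalar f -> f (k *: x) = k * f x.
  move=> lf; have f0 : f 0 = 0 by have := lf (-1) 0 0; rewrite scaler0 addr0; lra.
  by have := lf k x 0; rewrite !addr0 f0 addr0.
have ax1 : a t0 x1 = 1 by rewrite sZ// mulVf ?gt_eqF.
pose p (x : V) := x - a t0 x *: x1.
have lp (f : V -> R) : scalar f -> forall x, f (p x) = f x - a t0 x * f x1.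
  by move=> lf x; rewrite /p addrC -scaleNr lf; ring.
have lap (f : V -> R) : scalar f -> scalar (fun x => f (p x)).
  by move=> lf k u w; rewrite !lp// lf la; ring.
have [l l0 lE] : exists2 l : T -> R, forall t, 0 <= l t &
    forall x, c (p x) = \sum_(t <- s) l t * a t (p x).
  apply: IH => // [t||x axp]; [exact: lap|exact: lap|].
  apply: ac => t; rewrite inE => /predU1P[->|]; last exact: axp.
  by rewrite lp// ax1 mulr1 subrr.
(* Since [c x = c (p x) + a t0 x * c x1], substituting the multipliers found for the projections
   leaves exactly this coefficient on [a t0]. *)
pose m := c x1 - \sum_(t <- s) l t * a t x1.
have m0 : 0 <= m.
  rewrite subr_ge0 (@le_trans _ _ 0)//.
    rewrite big_seq sumr_le0// => t ts.
    by rewrite mulr_ge0_le0// sZ// mulr_ge0_le0 ?invr_ge0 ?(ltW a0x0)// ax0.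
  by rewrite sZ//; apply: mulr_ge0; rewrite ?invr_ge0 ltW.
exists (fun t => if t == t0 then m else l t) => [t|x]; first by case: ifP.
rewrite big_cons eqxx.
under eq_big_seq => t ts.
  rewrite (_ : (t == t0) = false); last by apply: contraNF t0s => /eqP <-.
  over.
have := lE x; rewrite lp// (eq_bigr (fun t => l t * a t x - a t0 x * (l t * a t x1))).
  by rewrite big_split/= sumrN -mulr_sumr /m; lra.
by move=> t _; rewrite lp//; ring.
Qed.

Section dot.
Context (R : realType) (d : nat).
Implicit Types x y z : 'rV[R]_d.

Lemma dotC x y : dot x y = dot y x.
Proof. by apply: eq_bigr => i _; rewrite mulrC. Qed.

Lemma dotDr x y z : dot x (y + z) = dot x y + dot x z.
Proof. by rewrite -big_split; apply: eq_bigr => i _; rewrite mxE mulrDr. Qed.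

Lemma dotZr a x y : dot x (a *: y) = a * dot x y.
Proof. by rewrite mulr_sumr; apply: eq_bigr => i _; rewrite mxE mulrCA. Qed.

Lemma dot0r x : dot x 0 = 0.
Proof. by rewrite -(scale0r 0) dotZr mul0r. Qed.

Lemma dotNr x y : dot x (- y) = - dot x y.
Proof. by rewrite -scaleN1r dotZr mulN1r. Qed.

Lemma dotBr x y z : dot x (y - z) = dot x y - dot x z.
Proof. by rewrite dotDr dotNr. Qed.

Lemma dot_sumr (I : Type) (r : seq I) (P : pred I) x (F : I -> 'rV[R]_d) :
  dot x (\sum_(i <- r | P i) F i) = \sum_(i <- r | P i) dot x (F i).
Proof.
by elim/big_rec2: _ => [|i a b _ <-]; rewrite ?dot0r ?dotDr.
Qed.

Lemma dotDl x y z : dot (y + z) x = dot y x + dot z x.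
Proof. by rewrite dotC dotDr !(dotC x). Qed.

Lemma dotZl a x y : dot (a *: y) x = a * dot y x.
Proof. by rewrite dotC dotZr dotC. Qed.

Lemma dotNl x y : dot (- y) x = - dot y x.
Proof. by rewrite dotC dotNr dotC. Qed.

Lemma dotBl x y z : dot (y - z) x = dot y x - dot z x.
Proof. by rewrite dotDl dotNl. Qed.

Lemma dot_suml (I : Type) (r : seq I) (P : pred I) x (F : I -> 'rV[R]_d) :
  dot (\sum_(i <- r | P i) F i) x = \sum_(i <- r | P i) dot (F i) x.
Proof. by rewrite dotC dot_sumr; apply: eq_bigr => i _; rewrite dotC. Qed.

Lemma dot_ge0 x : 0 <= dot x x.
Proof. by apply: sumr_ge0 => i _; exact: sqr_ge0. Qed.

Lemma dot_eq0 x : dot x x = 0 -> x = 0.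
Proof.
move=> /eqP; rewrite psumr_eq0; last by move=> i _; exact: sqr_ge0.
move=> /allP xx0; apply/rowP => i; rewrite mxE.
by have := xx0 i (mem_index_enum _); rewrite -expr2 sqrf_eq0 => /eqP.
Qed.

Lemma norm2_ge0 x : 0 <= norm2 x.
Proof. exact: sqrtr_ge0. Qed.

Lemma norm2_sqr x : norm2 x ^+ 2 = dot x x.
Proof. by rewrite sqr_sqrtr// dot_ge0. Qed.

Lemma norm2_le x (a : R) : 0 <= a -> (norm2 x <= a) = (dot x x <= a ^+ 2).
Proof. by move=> a0; rewrite -norm2_sqr ler_sqr// nnegrE norm2_ge0. Qed.

Lemma norm2N x : norm2 (- x) = norm2 x.
Proof. by rewrite /norm2 dotNl dotNr opprK. Qed.

Lemma cauchy_schwarz x y : dot x y <= norm2 x * norm2 y.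
Proof.
have [x0|x0] := eqVneq (norm2 x) 0.
  have -> : x = 0 by apply: dot_eq0; rewrite -norm2_sqr x0 expr0n.
  by rewrite dotC dot0r mulr_ge0 ?norm2_ge0.
have [y0|y0] := eqVneq (norm2 y) 0.
  have -> : y = 0 by apply: dot_eq0; rewrite -norm2_sqr y0 expr0n.
  by rewrite dot0r mulr_ge0 ?norm2_ge0.
have xy : 0 < norm2 x * norm2 y by rewrite mulr_gt0// lt0r ?x0 ?y0 norm2_ge0.
have := dot_ge0 (norm2 y *: x - norm2 x *: y).
rewrite !(dotBl, dotBr, dotZl, dotZr) (dotC y x) -!norm2_sqr => h.
by rewrite -(ler_pM2l xy); clear -h; lra.
Qed.

End dot.

Lemma convex_functionP (R : realType) (d : nat) (f : 'rV[R]_d -> R) :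
  @convex_function R 'rV[R]_d [set: convex_lmodType 'rV[R]_d] f <->
  forall (t : R) (x y : 'rV[R]_d), 0 <= t -> t <= 1 ->
    f (t *: x + (1 - t) *: y) <= t * f x + (1 - t) * f y.
Proof.
split=> [cf t x y t0 t1|cf t x y _ _]; last first.
  exact: (cf t%:num x y (ge0 _) (le1 _)).
exact: (cf (Itv01 t0 t1) x y (in_setT _) (in_setT _)).
Qed.

(** Induction merges each new point with the barycentre of the rest. The weights are not normalized,
    so a total weight 0 is allowed; any [y] works there. *)
Lemma convex_jensen (R : realType) (d : nat) (f : 'rV[R]_d -> R) (I : Type)
    (s : seq I) (a : I -> R) (x : I -> 'rV[R]_d) :
  @convex_function R 'rV[R]_d [set: convex_lmodType 'rV[R]_d] f ->
  (forall i, 0 <= a i) ->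
  exists2 y, \sum_(i <- s) a i *: x i = (\sum_(i <- s) a i) *: y &
    (\sum_(i <- s) a i) * f y <= \sum_(i <- s) a i * f (x i).
Proof.
move=> cf a0; elim: s => [|i s [y xy fy]].
  by exists 0; rewrite !big_nil ?scale0r ?mul0r.
rewrite !big_cons; set S := \sum_(j <- s) a j in xy fy *.
have S0 : 0 <= S by exact: sumr_ge0.
have [aS|aS] := eqVneq (a i + S) 0.
  have ai0 : a i = 0 by have := a0 i; lra.
  have S00 : S = 0 by lra.
  exists y; first by rewrite xy ai0 scale0r !add0r.
  by rewrite ai0 !mul0r !add0r.
have aS0 : 0 < a i + S by rewrite lt0r aS addr_ge0.
have t0 : 0 <= a i / (a i + S) by rewrite divr_ge0// addr_ge0.
have t1 : a i / (a i + S) <= 1 by rewrite ler_pdivrMr// mul1r lerDl.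
move: cf => /convex_functionP cf.
pose t := a i / (a i + S).
have tE : (a i + S) * t = a i by rewrite mulrC divfK.
have tE' : (a i + S) * (1 - t) = S by rewrite mulrBr tE; ring.
exists (t *: x i + (1 - t) *: y); first by rewrite xy scalerDr !scalerA tE tE'.
have := cf t (x i) y t0 t1; rewrite -(ler_pM2l aS0).
by rewrite [leRHS]mulrDr (mulrA _ t) tE (mulrA _ (1 - t)) tE' => /le_trans; apply; rewrite lerD2l.
Qed.

(** * Hard instances *)

Section gram.
Context (R : realType) (n : nat).
Implicit Types A B : 'M[R]_n.

Definition gram A := exists d (G : 'I_n -> 'rV[R]_d), forall i j, dot (G i) (G j) = A i j.

Lemma gram0 : gram 0.
Proof. by exists 0, (fun=> 0) => i j; rewrite dot0r mxE. Qed.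

(** Concatenating the coordinates of two families adds their inner products; this is why [gram]
    leaves the dimension free. *)
Lemma gramD A B : gram A -> gram B -> gram (A + B).
Proof.
move=> [d [G GA]] [e [H HB]]; exists (d + e)%N, (fun i => row_mx (G i) (H i)).
move=> i j; rewrite mxE -GA -HB /dot big_split_ord/=.
by congr (_ + _); apply: eq_bigr => k _; rewrite ?row_mxEl ?row_mxEr.
Qed.

Lemma gram_sum (I : Type) (s : seq I) (P : pred I) (F : I -> 'M[R]_n) :
  (forall i, gram (F i)) -> gram (\sum_(i <- s | P i) F i).
Proof. by move=> FG; elim/big_ind: _ => //; [exact: gram0|exact: gramD]. Qed.

Lemma gram_rank1 (a : R) (v : 'I_n -> R) :
  0 <= a -> gram (\matrix_(i, j) (a * (v i * v j))).
Proof.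
move=> a0; exists 1%N, (fun i => const_mx (Num.sqrt a * v i)) => i j.
by rewrite /dot big_ord1 !mxE mulrACA -expr2 sqr_sqrtr.
Qed.

(* [B i j] is produced off the diagonal by rank-one matrices supported on
   [{i, j}], each of which adds [`|B i j|] to the diagonal. *)
Lemma gram_diag_dominant (a : R) B :
  (forall i j, B i j = B j i) ->
  (forall i, \sum_j `|B i j| <= a) -> gram (a%:M + B).
Proof.
move=> Bsym Ba.
(* [F] uses up the slack of the diagonal, nonnegative by dominance; [H] has weight one half because
   every pair [{i, j}] occurs in both orders. *)
pose F i := \matrix_(p, q) ((a - \sum_j `|B i j|) * ((i == p)%:R * (i == q)%:R)) : 'M[R]_n.
pose v i j p : R := (i == p)%:R + Num.sg (B i j) * (j == p)%:R.
pose H i j := \matrix_(p, q) (`|B i j| / 2 * (v i j p * v i j q)) : 'M[R]_n.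
have delta (G : 'I_n -> R) p : \sum_i (i == p)%:R * G i = G p.
  rewrite (bigD1 p)//= eqxx mul1r big1 ?addr0// => i /negbTE ->.
  by rewrite mul0r.
suff -> : a%:M + B = \sum_i F i + \sum_i \sum_j H i j.
  apply: gramD; apply: gram_sum => i.
    by apply: gram_rank1; rewrite subr_ge0.
  by apply: gram_sum => j; apply: gram_rank1; rewrite divr_ge0.
apply/matrixP => p q; rewrite !(mxE, summxE).
under eq_bigr do rewrite mxE mulrCA.
rewrite delta.
have HE i j : H i j p q =
  (i == p)%:R * ((i == q)%:R * (`|B i j| / 2)) +
  (i == p)%:R * ((j == q)%:R * (B i j / 2)) +
  (i == q)%:R * ((j == p)%:R * (B i j / 2)) +
  (j == p)%:R * ((j == q)%:R * (`|B i j| / 2)).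
  by rewrite mxE /v; case: sgrP => [->|_|_]; field.
under [X in _ = _ + X]eq_bigr => i _ do
  (rewrite summxE; under eq_bigr do rewrite HE; rewrite !big_split/=).
have delta2 (G : 'I_n -> 'I_n -> R) k :
    \sum_i \sum_j (i == k)%:R * G i j = \sum_j G k j.
  by rewrite -(delta (fun i => \sum_j G i j)); apply: eq_bigr => i _; rewrite mulr_sumr.
rewrite !big_split/= !delta2 !delta.
under [X in _ = _ + (_ + X)]eq_bigr do rewrite delta.
under [X in _ = _ + (_ + X)]eq_bigr do rewrite Bsym.
by rewrite -!mulr_sumr -!mulr_suml (Bsym q) -[a *+ _]mulr_natr; field.
Qed.
End gram.

Lemma near_right_mul_le (R : realType) (c K : R) :
  0 < c -> \forall e \near 0^'+, e * K <= c.
Proof.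
move=> c0; near=> e.
have K1 : 0 < 1 + `|K| by rewrite ltr_pwDl.
have : e < c / (1 + `|K|).
  by near: e; apply: nbhs_right_lt; rewrite divr_gt0.
rewrite ltr_pdivlMr// => /ltW; apply: le_trans.
by rewrite ler_wpM2l// (le_trans (ler_norm _))// lerDr.
Unshelve. all: by end_near. Qed.

(* [W] as a strictly lower triangular matrix whose rows and columns are both
   indexed by [{0, ..., N}]: [ext W n j] is the paper's [W_{n,j}]. *)
Definition ext (R : realType) (N : nat) (W : 'M[R]_N) : 'M[R]_N.+1 :=
  \matrix_(i, j)
    if (unlift ord0 i, unlift ord_max j) is (Some r, Some k) then W r k else 0.

Section ext.
Context (R : realType) (N : nat) (W : 'M[R]_N).
Local Notation inj := (widen_ord (leqnSn N)).

Lemma widen_lift (k : 'I_N) : inj k = lift ord_max k.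
Proof. by apply: val_inj; rewrite [RHS]lift_max. Qed.

Lemma extE r k : ext W (lift ord0 r) (inj k) = W r k.
Proof. by rewrite mxE widen_lift !liftK. Qed.

Lemma ext_col_max i : ext W i ord_max = 0.
Proof. by rewrite mxE unlift_none; case: unliftP. Qed.

Lemma ext_eq0 : is_trig_mx W ->
  forall i j : 'I_N.+1, (i <= j)%N -> ext W i j = 0.
Proof.
move=> /is_trig_mxP tW i j; rewrite mxE.
case: unliftP => [r ->|//]; case: unliftP => [k ->|//].
by rewrite lift_max lift0 => rk; apply: tW.
Qed.

Lemma ltn_lift (n j : 'I_N.+1) : (j < n)%N ->
  exists r k : 'I_N, [/\ n = lift ord0 r, j = inj k & (k <= r)%N].
Proof.
case: (unliftP ord0 n) => [r ->|-> //]; rewrite lift0 ltnS => jr.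
have jN : (j < N)%N by apply: leq_ltn_trans jr (ltn_ord r).
by exists r, (Ordinal jN); split => //; apply: val_inj.
Qed.

Lemma trajectory_ext (d : nat) (x : 'I_N.+1 -> 'rV[R]_d)
    (g : 'I_N.+1 -> 'rV[R]_d) : is_trig_mx W ->
  (forall r : 'I_N, x (lift ord0 r) =
    x ord0 - \sum_(i < N | (i <= r)%N) W r i *: g (inj i)) <->
  (forall n, x n = x ord0 - \sum_k ext W n k *: g k).
Proof.
move=> tW.
have E (r : 'I_N) : \sum_(i < N | (i <= r)%N) W r i *: g (inj i) =
    \sum_k ext W (lift ord0 r) k *: g k.
  rewrite big_ord_recr/= ext_col_max scale0r addr0 big_mkcond/=.
  apply: eq_bigr => i _; rewrite extE; case: leqP => // ri.
  by rewrite (is_trig_mxP tW)// scale0r.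
split=> [xE n|xE r]; last by rewrite E.
case: (unliftP ord0 n) => [r ->|->]; first by rewrite xE E.
by rewrite big1 ?subr0// => k _; rewrite ext_eq0// scale0r.
Qed.
End ext.

Section max_affine.
Context (R : realType) (d : nat) (I : finType) (w : R) (b : I -> R)
  (h : I -> 'rV[R]_d).

Definition max_affine x := \big[Num.max/w]_l (b l + dot (h l) x).

Lemma max_affine_ge x l : b l + dot (h l) x <= max_affine x.
Proof. exact: le_bigmax. Qed.

Lemma max_affine_ge_floor x : w <= max_affine x.
Proof. exact: bigmax_ge_id. Qed.

Lemma max_affine_le x c : w <= c -> (forall l, b l + dot (h l) x <= c) ->
  max_affine x <= c.
Proof. by move=> wc lc; apply: bigmax_le => // l _. Qed.

Lemma max_affine_convex :
  @convex_function R 'rV[R]_d [set: convex_lmodType 'rV[R]_d] max_affine.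
Proof.
apply/convex_functionP => t x y t0 t1; apply: max_affine_le => [|l].
  have := max_affine_ge_floor x; have := max_affine_ge_floor y; nra.
have := max_affine_ge x l; have := max_affine_ge y l.
rewrite dotDr !dotZr; nra.
Qed.

Lemma max_affine_lipschitz (M : R) : 0 <= M ->
  (forall l, dot (h l) (h l) <= M ^+ 2) ->
  forall x y, `|max_affine x - max_affine y| <= M * norm2 (x - y).
Proof.
move=> M0 hM.
have le x y : max_affine x <= max_affine y + M * norm2 (x - y).
  apply: max_affine_le => [|l].
    by rewrite (le_trans (max_affine_ge_floor y))// lerDl mulr_ge0 ?norm2_ge0.
  rewrite -[in leLHS](subrK y x) dotDr addrCA addrC lerD ?max_affine_ge//.
  rewrite (le_trans (cauchy_schwarz _ _))// ler_wpM2r ?norm2_ge0//.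
  by rewrite norm2_le.
move=> x y; rewrite ler_norml lerBlDl le andbT lerNl opprB lerBlDl.
by rewrite -[x - y]opprB norm2N le.
Qed.

End max_affine.

(** Reduces a bad run started at 0 to finitely many inequalities. Piece [kappa i] is active at
    [x i], so its slope is a subgradient there; at [xs] no piece exceeds the floor [w], so [xs] is a
    minimizer. *)
Lemma hard_instance (R : realType) (M D : R) (N : nat) (W : 'M[R]_N)
    (d : nat) (I : finType) (w : R) (b : I -> R) (h : I -> 'rV[R]_d)
    (kappa : 'I_N.+1 -> I) (xs : 'rV[R]_d)
    (x := fun n => - \sum_k ext W n k *: h (kappa k)) :
  0 <= M -> 0 <= D -> is_trig_mx W ->
  (forall l, dot (h l) (h l) <= M ^+ 2) ->
  (forall i l, b l + dot (h l) (x i) <= b (kappa i) + dot (h (kappa i)) (x i)) ->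
  (forall i, w <= b (kappa i) + dot (h (kappa i)) (x i)) ->
  (forall l, b l + dot (h l) xs <= w) -> dot xs xs <= D ^+ 2 ->
  final_gaps M D W
    (b (kappa ord_max) + dot (h (kappa ord_max)) (x ord_max) - w).
Proof.
move=> M0 D0 tW hM kx wx bxs xsD.
have x0 : x ord0 = 0.
  by rewrite /x big1 ?oppr0// => k _; rewrite ext_eq0// scale0r.
have fx i : max_affine w b h (x i) = b (kappa i) + dot (h (kappa i)) (x i).
  by apply/eqP; rewrite eq_le max_affine_ge andbT max_affine_le.
have fxs : max_affine w b h xs = w.
  by apply/eqP; rewrite eq_le max_affine_ge_floor andbT max_affine_le.
have mxs : minimizer (max_affine w b h) xs.
  by move=> y; rewrite fxs max_affine_ge_floor.
exists d, (max_affine w b h), x,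
  (fun k => h (kappa (widen_ord (leqnSn N) k))), xs; split=> //.
- split; first exact: max_affine_convex.
  + exact: max_affine_lipschitz.
  + by exists xs; split=> //; rewrite x0 sub0r norm2N norm2_le.
- split=> [i y|].
    rewrite fx -addrA -dotDr (addrC (x _)) subrK; exact: max_affine_ge.
  apply/(trajectory_ext x (fun k => h (kappa k)) tW) => n.
  by rewrite x0 sub0r.
- by rewrite fx fxs.
Qed.

(* Instance with Gram matrix [M^2 I - e Y], [f(x_i) = e u_i] and
   [x_star = - sum_k be k g_k], where [be] solves [<g_l, x_star> = - v - e (a l + delta)]
   up to order [e^2].  The last hypothesis says that the first-order variation
   of [|x_star|^2] is negative, which leaves room for the margin [delta]. *)
Lemma perturbed_instance (R : realType) (M D v : R) (N : nat) (W : 'M[R]_N)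
    (Y : 'M[R]_N.+1) (u : 'I_N.+1 -> R) (L := ext W) (n1 := N.+1%:R : R) :
  0 < M -> 0 <= D -> 0 < v -> n1 * v ^+ 2 = M ^+ 2 * D ^+ 2 -> is_trig_mx W ->
  (forall i j, Y i j = Y j i) -> (forall i, Y i i = 0) ->
  (forall i j : 'I_N.+1, (j < i)%N -> 0 < L i j) ->
  (forall i l : 'I_N.+1, (i < l)%N ->
    0 <= \sum_j Y l j * (L l j - L i j) + u i - u l) ->
  v / M ^+ 2 / 2 * (\sum_i \sum_j Y i j) - \sum_i \sum_j Y i j * L i j
    + \sum_i u i - n1 * u ord_max < 0 ->
  exists2 gap, final_gaps M D W gap & v < gap.
Proof.
move=> M0 D0 v0 vE tW Ysym Ydiag Lpos C1 C2.
have M20 : 0 < M ^+ 2 by rewrite exprn_gt0.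
have M2n0 : M ^+ 2 != 0 by rewrite gt_eqF.
have n10 : 0 < n1 by rewrite ltr0n.
have n1n0 : n1 != 0 by rewrite gt_eqF.
have vn0 : v != 0 by rewrite gt_eqF.
(* At [e = 0] the [g_k] are orthogonal of norm [M], and [x_star = - q sum_k g_k] gives
   [<g_l, x_star> = - v] for all [l]. *)
pose q := v / M ^+ 2.
have q0 : 0 < q by rewrite divr_gt0.
(* The first-order coefficient in [e] of [<g_l, x_i>]. *)
pose S l i := \sum_k Y l k * L i k.
pose YS l := \sum_k Y l k.
pose eta := - (q / 2 * (\sum_i YS i) - \sum_i S i i + \sum_i u i - n1 * u ord_max).
have eta0 : 0 < eta by rewrite oppr_gt0.
(* The first-order variation of [|x_star|^2] is proportional to [- 2 eta + 2 n1 delta]; this [delta]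
   gives up half of the decrease and leaves [- eta]. *)
pose delta : R := eta / (2 * n1).
have delta0 : 0 < delta by rewrite divr_gt0// mulr_gt0.
have deltaE : 2 * n1 * delta = eta by rewrite mulrC divfK// mulf_neq0.
clearbody delta.
pose a l := u l - u ord_max - S l l.
pose b l := (a l + q * YS l + delta) / v.
have vb l : v * b l = a l + q * YS l + delta by rewrite mulrC divfK.
pose r l := q * \sum_k Y l k * b k.
pose A := \sum_l (b l * (a l + delta) - r l).
pose B := - \sum_l b l * r l.
have T : \sum_l (v * b l + a l + delta) = - eta.
  under eq_bigr do rewrite vb /a.
  rewrite !big_split/= -!mulr_sumr !sumrN !sumr_const card_ord.
  rewrite -(mulr_natl delta) -(mulr_natl (u ord_max)).
  rewrite -/n1 -deltaE; have := deltaE; rewrite /eta; clear; lra.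
near (0 : R)^'+ => e.
have e0 : 0 < e by near: e; exact: nbhs_right_gt.
have e1 : e <= 1 by near: e; exact: nbhs_right_le.
have eY l : e * (\sum_j `|Y l j|) <= M ^+ 2.
  by move: l; near: e; apply: filter_forall => l; exact: near_right_mul_le.
have er l : e * r l <= delta / 2.
  move: l; near: e; apply: filter_forall => l; apply: near_right_mul_le.
  by rewrite divr_gt0.
have eL (i l : 'I_N.+1) : (l < i)%N -> e * (u l - u i - (S l l - S l i)) <= M ^+ 2 * L i l.
  move: i l; near: e; apply: filter_forall => i; apply: filter_forall => l.
  have [li|_] := ltnP l i; last exact: nearW.
  have : 0 < M ^+ 2 * L i l by rewrite mulr_gt0// Lpos.
  move=> /near_right_mul_le => /(_ (u l - u i - (S l l - S l i))).
  by apply: filterS => x ? _.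
have eu i : e * (u ord_max - delta / 2 - u i) <= v.
  by move: i; near: e; apply: filter_forall => i; exact: near_right_mul_le.
have eA : e * A <= eta / 2.
  by near: e; apply: near_right_mul_le; rewrite divr_gt0.
have eB : e * `|B| <= eta / 2.
  by near: e; apply: near_right_mul_le; rewrite divr_gt0.
have [d [g gE]] : gram ((M ^+ 2)%:M - e *: Y).
  apply: gram_diag_dominant => [i j|i]; first by rewrite !mxE Ysym.
  under eq_bigr do rewrite !mxE normrN normrM (gtr0_norm e0).
  by rewrite -mulr_sumr.
pose x n : 'rV_d := - \sum_k L n k *: g k.
have gcomb l (be : 'I_N.+1 -> R) :
    dot (g l) (\sum_k be k *: g k) = M ^+ 2 * be l - e * \sum_k Y l k * be k.
  rewrite dot_sumr.
  under eq_bigr do rewrite dotZr gE !mxE mulrDr mulrb.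
  rewrite big_split/=; congr (_ + _).
    rewrite (bigD1 l)//= eqxx mulrC big1 ?addr0// => k.
    by rewrite eq_sym => /negbTE ->; rewrite mulr0.
  by rewrite mulr_sumr -sumrN; apply: eq_bigr => k _; ring.
have gx l i : dot (g l) (x i) = - (M ^+ 2 * L i l) + e * S l i.
  by rewrite dotNr gcomb opprB addrC.
have Ldiag i : L i i = 0 by exact: ext_eq0.
pose cst l := e * (u l - S l l).
have cx i : cst i + dot (g i) (x i) = e * u i.
  by rewrite gx Ldiag /cst; ring.
(* Half of the margin [delta] absorbs the second-order term [e * (e * r l)] of [<g_l, x_star>]; the
   other half is the excess of the gap over [v]. *)
pose w := - v + e * u ord_max - e * delta / 2.
pose be k := q * (1 + e * b k).
pose xs : 'rV_d := - \sum_k be k *: g k.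
have qv : M ^+ 2 * q = v by rewrite mulrC divfK.
have gxs l : dot (g l) xs = - v - e * (v * b l) + e * q * YS l + e * (e * r l).
  rewrite dotNr gcomb /be mulrA qv.
  under eq_bigr do rewrite mulrCA mulrDr mulr1 mulrCA.
  by rewrite -mulr_sumr big_split/= -mulr_sumr -/(YS l) /r; ring.
exists (cst ord_max + dot (g ord_max) (x ord_max) - w); last first.
  rewrite cx /w; have : 0 < e * delta by rewrite mulr_gt0.
  lra.
apply: (@hard_instance _ M D N W d _ w cst g id xs) => //.
- exact: ltW.
- by move=> l; rewrite gE !mxE eqxx mulr1n Ydiag mulr0 subr0.
- move=> i l; change (cst l + dot (g l) (x i) <= cst i + dot (g i) (x i)).
  rewrite cx gx /cst.
  (* For [l < i] the slack [M ^+ 2 * L i l] does not vanish with [e] and dominates. For [i < l] the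
     entry [L i l] is 0 and the comparison, now of order [e], is exactly [C1]. *)
  have [li|il|/val_inj ->] := ltngtP l i.
  + by have := eL i l li; clear; lra.
  + have := C1 i l il; rewrite -(pmulr_rge0 _ e0) [L i l]ext_eq0 1?ltnW//.
    have -> : \sum_j Y l j * (L l j - L i j) = S l l - S l i.
      by rewrite -sumrB; apply: eq_bigr => j _; rewrite mulrBr.
    by clear; lra.
  + by rewrite Ldiag; clear; lra.
- move=> i; change (w <= cst i + dot (g i) (x i)).
  by rewrite cx /w; have := eu i; clear; lra.
- move=> l; rewrite gxs vb /cst /w /a.
  by have := ler_wpM2l (ltW e0) (er l); clear; lra.
have -> : dot xs xs = D ^+ 2 + q * e * (- eta + e * A + e * (e * B)).
  have -> : dot xs xs = - \sum_l be l * dot (g l) xs.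
    rewrite -[LHS]opprK -dotNl opprK dot_suml; congr (- _).
    by apply: eq_bigr => l _; rewrite dotZl.
  have qD : q * (n1 * v) = D ^+ 2.
    by rewrite /q mulrAC [v * (_ * _)]mulrCA -expr2 vE mulrC mulKf.
  rewrite -qD -T /A /B -!sumrN.
  transitivity (\sum_l q * (v + e * (v * b l + a l + delta)
      + e * (e * (b l * (a l + delta) - r l)) + e * (e * (e * - (b l * r l))))).
    apply: eq_bigr => l _; rewrite gxs /be.
    have -> : e * q * YS l = e * (v * b l - a l - delta) by rewrite vb; ring.
    by ring.
  rewrite -mulr_sumr [in LHS]big_split [in LHS]big_split [in LHS]big_split/= -!mulr_sumr.
  rewrite sumr_const card_ord -[v *+ _]mulr_natl -/n1.
  by ring.
rewrite gerDl (pmulr_rle0 _ (mulr_gt0 q0 e0)).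
have : e * (e * B) <= eta / 2.
  apply: le_trans eB; apply: (le_trans (ler_norm _)).
  rewrite !normrM (gtr0_norm e0) (ler_wpM2l (ltW e0))//.
  by rewrite ler_piMl.
by have := eA; clear; lra.
Unshelve. all: by end_near. Qed.

(** The function is [M] times the largest coordinate, cut off at [- M * D / sqrt d]. Coordinate [l]
    of [x_i] is [- M * X i l], so the hypotheses make [kappa i] a largest coordinate, with
    nonnegative value. A minimizer has all coordinates equal to [- D / sqrt d]. *)
Lemma coordinate_instance (R : realType) (M D : R) (N : nat) (W : 'M[R]_N)
    (d : nat) (kappa : 'I_N.+1 -> 'I_d)
    (X := fun i l => \sum_(k | kappa k == l) ext W i k) :
  0 <= M -> 0 <= D -> is_trig_mx W ->
  (forall i l, X i (kappa i) <= X i l) -> (forall i, X i (kappa i) <= 0) ->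
  exists2 gap, final_gaps M D W gap & M * D / Num.sqrt d%:R <= gap.
Proof.
move=> M0 D0 tW Xmin X0.
have d0 : (0 < d)%N by case: (kappa ord0) => m /(leq_ltn_trans (leq0n m)).
have s0 : 0 < Num.sqrt d%:R :> R by rewrite sqrtr_gt0 ltr0n.
have ss : d%:R = Num.sqrt d%:R ^+ 2 :> R by rewrite sqr_sqrtr.
set s := Num.sqrt d%:R in s0 ss *.
pose h l : 'rV[R]_d := M *: delta_mx 0 l.
have hE l y : dot (h l) y = M * y 0 l.
  rewrite /h dotZl; congr (_ * _); rewrite /dot (bigD1 l)//= mxE !eqxx mul1r.
  rewrite big1 ?addr0// => k /negbTE kl.
  by rewrite mxE kl andbF mul0r.
pose x n := - \sum_k ext W n k *: h (kappa k).
have xE n l : x n 0 l = - (M * X n l).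
  rewrite !mxE summxE mulr_sumr [in RHS]big_mkcond/=; congr (- _).
  apply: eq_bigr => k _; rewrite !mxE eqxx/= eq_sym; case: eqP => _.
    by rewrite mulr1 mulrC.
  by rewrite !mulr0.
pose xs : 'rV[R]_d := const_mx (- (D / s)).
exists (0 + dot (h (kappa ord_max)) (x ord_max) - - (M * D / s)); last first.
  by rewrite add0r opprK hE xE lerDr mulr_ge0// oppr_ge0 mulr_ge0_le0.
apply: (@hard_instance _ M D N W d _ _ (fun=> 0) h kappa xs) => //.
- by move=> l; rewrite hE !mxE !eqxx mulr1 expr2.
- move=> i l; rewrite !add0r !hE -/(x i) !xE ler_wpM2l// lerN2.
  by rewrite ler_wpM2l// Xmin.
- move=> i; rewrite add0r hE -/(x i) xE (@le_trans _ _ 0)//.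
    by rewrite oppr_le0 divr_ge0 ?mulr_ge0// ltW.
  by rewrite mulr_ge0// oppr_ge0 mulr_ge0_le0.
- by move=> l; rewrite add0r hE mxE mulrN mulrA.
- rewrite /dot; under eq_bigr do rewrite !mxE.
  rewrite sumr_const card_ord -[_ *+ d]mulr_natr ss le_eqVlt; apply/orP; left.
  by apply/eqP; field; rewrite gt_eqF.
Qed.

(** Combinatorics of the resisting oracle: [k i] is the coordinate answered at point [i]. The first
    [n] answers are all new; each later one is an argmin over the indices below [i], so [k] can be
    built one answer at a time. *)
Lemma repeating_index (R : realType) (V : nat -> nat -> R) (n m : nat) :
  (0 < n)%N ->
  exists k : nat -> nat, (forall i, (i < n)%N -> k i = i) /\
    forall i, (n <= i < m)%N -> (k i < i)%N /\
      forall l, (l < i)%N ->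
        \sum_(j < i | k j == k i) V i j <= \sum_(j < i | k j == l) V i j.
Proof.
move=> n0; elim: m => [|m [k [kn km]]].
  by exists id; split=> // i; rewrite ltn0 andbF.
have [mn|nm] := ltnP m n.
  exists k; split=> // i /andP[ni]; rewrite ltnS => /(leq_trans ni).
  by rewrite leqNgt mn.
have m0 : (0 < m)%N by exact: leq_trans nm.
pose F (c : 'I_m) : R := \sum_(j < m | k j == c) V m j.
pose c := [arg min_(c < Ordinal m0) F c]%O.
have cP l : F c <= F l.
  by rewrite /c; case: arg_minP => // i _ /(_ l); exact.
pose k' i := if i == m then val c else k i.
have k'E i : (i < m)%N -> k' i = k i by rewrite /k'; case: ltngtP.
have sumE i l : (i <= m)%N ->
    \sum_(j < i | k' j == l) V i j = \sum_(j < i | k j == l) V i j.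
  by move=> im; apply: eq_bigl => j; rewrite k'E// (leq_trans (ltn_ord j)).
exists k'; split=> [i ni|i].
  by rewrite k'E ?kn// (leq_trans ni).
rewrite ltnS [(i <= m)%N]leq_eqVlt => /andP[ni /predU1P[->|im]].
  have -> : k' m = c by rewrite /k' eqxx.
  split=> [|l lm]; [exact: ltn_ord|rewrite !sumE//].
  exact: (cP (Ordinal lm)).
have /km[kii kil] : (n <= i < m)%N by rewrite ni.
by rewrite k'E//; split=> // l li; rewrite !sumE ?(ltnW im)//; exact: kil.
Qed.

(* From the first row with a nonpositive entry on, the adversary can always
   answer with a coordinate already used, hence, although there are only [N]
   coordinates, one of them stays unexplored. *)
Lemma resisting_instance (R : realType) (M D : R) (N : nat) (W : 'M[R]_N)
    (i0 j0 : 'I_N.+1) :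
  0 <= M -> 0 <= D -> is_trig_mx W -> (j0 < i0)%N -> ext W i0 j0 <= 0 ->
  exists2 gap, final_gaps M D W gap & M * D / Num.sqrt N%:R <= gap.
Proof.
move=> M0 D0 tW ji0 L0.
case: N => [|N'] in W i0 j0 tW ji0 L0 *; first by rewrite (ord1 i0) in ji0.
pose bad (i : 'I_N'.+2) := [exists j : 'I_N'.+2, (j < i)%N && (ext W i j <= 0)].
have bi0 : bad i0 by apply/existsP; exists j0; rewrite ji0.
have [n /existsP[j /andP[jn Lnj]] nmin] := arg_minnP (@nat_of_ord N'.+2) bi0.
have n0 : (0 < n)%N by exact: leq_ltn_trans jn.
have Lpos (i l : 'I_N'.+2) : (i < n)%N -> (l < i)%N -> 0 < ext W i l.
  move=> inn li; rewrite ltNge; apply/negP => Lil.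
  have /nmin : bad i by apply/existsP; exists l; rewrite li.
  by rewrite leqNgt inn.
pose V (a b : nat) := ext W (inord a) (inord b).
have [k [kn km]] := @repeating_index R V n N'.+2 n0.
have kle i : (i < N'.+2)%N -> (k i <= i)%N.
  move=> iN; have [/kn ->//|ni] := ltnP i n.
  by have /km[/ltnW] : (n <= i < N'.+2)%N by rewrite ni.
have kN (i : 'I_N'.+2) : (k i < N'.+1)%N.
  have [ni|ni] := ltnP i n; first by rewrite kn// (leq_trans ni)// -ltnS.
  have /km[kii _] : (n <= i < N'.+2)%N by rewrite ni ltn_ord.
  by rewrite (leq_trans kii)// -ltnS.
pose kappa (i : 'I_N'.+2) : 'I_N'.+1 := Ordinal (kN i).
have XE (i : 'I_N'.+2) (l : 'I_N'.+1) : \sum_(a | kappa a == l) ext W i a =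
    \sum_(a < i | k a == l) V i a.
  rewrite (big_ord_widen_cond N'.+2 (fun a => k a == l) (V i)) ?(ltnW (ltn_ord i))//.
  rewrite big_mkcond [RHS]big_mkcond/=; apply: eq_bigr => a _.
  rewrite -val_eqE/=; case: eqP => //= _; case: ltnP => ai.
    by rewrite /V !inord_val.
  by rewrite ext_eq0.
have X_eq0 (i : nat) (l : nat) : (forall a, (a < i)%N -> k a != l) ->
    \sum_(a < i | k a == l) V i a = 0.
  by move=> kl; rewrite big_pred0// => a; apply/negbTE/kl.
have Xle0 (i : 'I_N'.+2) : \sum_(a < i | k a == k i) V i a <= 0.
  have [ni|ni] := ltnP i n.
    rewrite X_eq0// => a ai; rewrite !kn ?(ltn_trans ai)//.
    by rewrite neq_ltn ai.
  have /km[kii kmin] : (n <= i < N'.+2)%N by rewrite ni ltn_ord.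
  (* Row [n] has a nonpositive entry, alone in its class since the earlier answers are distinct. In
     a later row, coordinate [i - 1] has not been answered yet and its sum is 0. Either way the
     minimum is nonpositive. *)
  move: ni; rewrite leq_eqVlt => /predU1P[/val_inj ni|ni].
    subst i; apply: le_trans (kmin j jn) _.
    rewrite (big_pred1 (Ordinal jn)) => [|a]; last by rewrite kn.
    by rewrite /V/= !inord_val.
  have i0' : (0 < i)%N by exact: leq_trans n0 (ltnW ni).
  apply: le_trans (kmin i.-1 _) _; first by rewrite prednK.
  rewrite X_eq0// => a ai.
  rewrite neq_ltn; apply/orP; left.
  have [an|na] := ltnP a n; first by rewrite kn// -ltnS prednK// (leq_ltn_trans an).
  have /km[kaa _] : (n <= a < N'.+2)%N by rewrite na (ltn_trans ai).
  by rewrite (leq_trans kaa)// -ltnS prednK.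
apply: (@coordinate_instance R M D N'.+1 W N'.+1 kappa) => // [i l|i]; last first.
  by rewrite XE; exact: Xle0.
rewrite !XE/=; have [li|il] := leqP i l.
  rewrite [leRHS]X_eq0 ?Xle0// => a ai; rewrite neq_ltn.
  rewrite (leq_ltn_trans (kle a _)) ?(leq_trans ai)//.
  exact: ltnW (ltn_ord i).
have [ni|ni] := ltnP i n; last first.
  have /km[_] : (n <= i < N'.+2)%N by rewrite ni ltn_ord.
  exact.
apply: le_trans (Xle0 i) _.
apply: sumr_ge0 => a _; rewrite /V inord_val ltW// Lpos// inordK//.
exact: ltn_trans (ltn_ord a) (ltn_ord i).
Qed.

(** * The polyhedron and its multipliers *)

Lemma sym_sum (R : realType) (n : nat) (F : 'I_n -> 'I_n -> R) :
  (forall i j, F i j = F j i) ->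
  \sum_i \sum_j F i j = \sum_i F i i + 2 * \sum_(i < n) \sum_(j < n | (j < i)%N) F i j.
Proof.
move=> Fsym.
have E i j : F i j = (if i == j then F i j else 0) +
    ((if (j < i)%N then F i j else 0) + (if (i < j)%N then F i j else 0)).
  by rewrite -val_eqE/=; case: ltngtP; rewrite ?addr0 ?add0r.
under eq_bigr => i _ do (under eq_bigr do rewrite E; rewrite !big_split/=).
rewrite !big_split/= [X in _ + (_ + X)]exchange_big/= mulr2n mulrDl !mul1r.
congr (_ + (_ + _)).
- apply: eq_bigr => i _; rewrite (bigD1 i)//= eqxx big1 ?addr0// => j.
  by rewrite eq_sym => /negbTE ->.
- by apply: eq_bigr => i _; rewrite -big_mkcond.
- by apply: eq_bigr => i _; rewrite -big_mkcond; apply: eq_bigr => j _.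
Qed.

Definition step (R : realType) (M D : R) (N : nat) : R :=
  D / (M * N.+1%:R `^ (3 / 2)).

Lemma stepE (R : realType) (M D : R) (N : nat) :
  step M D N = D / (M * Num.sqrt N.+1%:R ^+ 3).
Proof.
by rewrite /step [3 / 2]mulrC powRrM powR12_sqrt// powR_mulrn// sqrtr_ge0.
Qed.

Section recursion.
Context (R : realType) (M D : R) (N : nat) (lam : 'M[R]_N.+1).
Context (lamP : polyhedron R N lam).
Implicit Types W : 'M[R]_N.
Local Notation c := (step M D N).

Lemma polyhedron_ge0 i j : 0 <= lam i j.
Proof.
by case: lamP => l0 lge0 _; have [/l0 ->|/lge0] := leqP j i.
Qed.

Lemma LamE n : Lam lam n = N.+1%:R^-1 + \sum_i lam i n.
Proof.
case: lamP => l0 _ _; rewrite /Lam big_mkcond; congr (_ + _).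
by apply: eq_bigr => i _; case: ltnP => // /l0 ->.
Qed.

(** Conservation of flow: each node has a source [1/(N+1)], and everything leaves through node [N].
    The equation at [N] follows by summing the others, since the total net flow vanishes. *)
Lemma Lam_flow n : Lam lam n - \sum_i lam n i = (n == ord_max)%:R.
Proof.
have flow (j : 'I_N.+1) : (j < N)%N -> \sum_i lam j i - \sum_i lam i j = N.+1%:R^-1.
  case: lamP => l0 _ lE /lE <-; rewrite [X in _ = X - _]big_mkcond.
  rewrite [X in _ = _ - X]big_mkcond; congr (_ - _).
    by apply: eq_bigr => i _; case: ltnP => // /l0 ->.
  by apply: eq_bigr => i _; case: ltnP => // /l0 ->.
have total : \sum_j (\sum_i lam j i - \sum_i lam i j) = 0.
  by rewrite sumrB [X in _ - X]exchange_big subrr.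
case: (unliftP ord_max n) => [k ->|->]; rewrite LamE; last first.
  move: total; rewrite big_ord_recr/= (eq_bigr (fun=> N.+1%:R^-1)); last first.
    by move=> i _; exact: (flow (widen_ord _ i) (ltn_ord i)).
  rewrite sumr_const card_ord eqxx -[_ *+ N]mulr_natl => total.
  have : (N.+1%:R : R)^-1 + N%:R * N.+1%:R^-1 = 1.
    by rewrite -{1}[_^-1]mul1r -mulrDl nat1r mulfV// pnatr_eq0.
  move: total; move: (\sum_i lam ord_max i) (\sum_i lam i ord_max).
  move=> a b /eqP; rewrite addr_eq0 => /eqP ->; rewrite opprB addrA; exact.
rewrite [_ == _](_ : _ = false); last by rewrite eq_sym (negbTE (neq_lift _ _)).
have := flow (lift ord_max k); rewrite lift_max => /(_ (ltn_ord k)).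
by move=> /eqP; rewrite subr_eq => /eqP ->; rewrite subrr.
Qed.

Lemma ext_sum W (r j : 'I_N) : is_trig_mx W ->
  \sum_i lam i (lift ord0 r) * ext W i (widen_ord (leqnSn N) j) =
  \sum_(k < N | (j <= k < r)%N) lam (lift ord0 k) (lift ord0 r) * W k j.
Proof.
move=> tW; rewrite big_ord_recl ext_eq0// mulr0 add0r [RHS]big_mkcond/=.
apply: eq_bigr => k _; rewrite extE; case: (leqP j k) => jk /=; last first.
  by rewrite (is_trig_mxP tW)// mulr0.
case: ltnP => // rk; case: lamP => -> //; first by rewrite mul0r.
Qed.

(** Clearing the denominator makes the recursion linear in [lam], the form that both inclusions
    need. The converse holds because the recursion determines the rows one after the other. *)
Lemma W_ofP W : is_trig_mx W ->
  W = W_of M D lam <-> forall n j : 'I_N.+1, (j < n)%N ->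
    Lam lam n * ext W n j = c + \sum_i lam i n * ext W i j.
Proof.
move=> tW; have L0 n : Lam lam n != 0 by rewrite gt_eqF// Lam_gt0.
split=> [WE n j /ltn_lift[r [k [-> -> kr]]]|WE].
  by rewrite ext_sum// extE {1}WE W_ofE// -WE /W_rhs mulVKf.
have WE' (r j : 'I_N) : (j <= r)%N -> W r j = W_rhs M D lam W r j.
  move=> jr; have := WE (lift ord0 r) (widen_ord (leqnSn N) j).
  rewrite lift0 ltnS => /(_ jr); rewrite ext_sum// extE => E.
  by rewrite /W_rhs -E mulKf.
have tV := W_of_trig M D lam.
suff rowE m (r j : 'I_N) : (r < m)%N -> W r j = W_of M D lam r j.
  by apply/matrixP => r j; exact: rowE.
elim: m r j => // m IH r j; rewrite ltnS => rm.
have [jr|rj] := leqP j r; last by rewrite (is_trig_mxP tW)// (is_trig_mxP tV).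
rewrite WE'// W_ofE// /W_rhs; congr (_ * (_ + _)).
by apply: eq_bigr => k /andP[_ kr]; rewrite IH// (leq_trans kr).
Qed.

End recursion.

(** * Upper bound for the methods [W(lambda)] *)

Section upper_bound.
Context (R : realType) (M D : R) (N : nat) (lam : 'M[R]_N.+1) (W : 'M[R]_N).
Local Notation c := (step M D N).
Local Notation L := (ext W).
Context (M0 : 0 < M) (D0 : 0 < D) (lamP : polyhedron R N lam).
Context (tW : is_trig_mx W) (WE : forall n j : 'I_N.+1, (j < n)%N ->
    Lam lam n * L n j = c + \sum_i lam i n * L i j).

Lemma step_gt0 : 0 < c.
Proof. by rewrite stepE divr_gt0// mulr_gt0// exprn_gt0// sqrtr_gt0. Qed.

Lemma ext_ge0 n j : 0 <= L n j.
Proof.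
suff H m : forall n j : 'I_N.+1, (n < m)%N -> 0 <= L n j by exact: (H N.+1).
elim: m => // m IH {}n {}j nm.
have [nj|jn] := leqP n j; first by rewrite ext_eq0.
rewrite -(pmulr_rge0 _ (Lam_gt0 n lamP)) WE// addr_ge0 ?(ltW step_gt0)//.
apply: sumr_ge0 => i _; have [ni|inn] := leqP n i.
  by case: lamP => -> //; rewrite mul0r.
apply: mulr_ge0; [exact: polyhedron_ge0|apply: IH; exact: leq_trans inn _].
Qed.

(** The recursion for [W] is what reduces the coefficient of every [g_k] with [k < n] to the same
    constant [- c], so that [lam] disappears from the right-hand side. *)
Lemma trajectory_residual (d : nat) (x g : 'I_N.+1 -> 'rV[R]_d) (xs : 'rV[R]_d) n :
  (forall n, x n = x ord0 - \sum_k L n k *: g k) ->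
  Lam lam n *: x n - \sum_i lam i n *: x i - N.+1%:R^-1 *: xs =
  N.+1%:R^-1 *: (x ord0 - xs) - c *: \sum_(k < N.+1 | (k < n)%N) g k.
Proof.
move=> xE.
have -> : \sum_i lam i n *: x i = (\sum_i lam i n) *: x ord0 -
    \sum_k (\sum_i lam i n * L i k) *: g k.
  under eq_bigr do rewrite xE scalerBr scaler_sumr.
  rewrite sumrB -scaler_suml exchange_big/=; congr (_ - _).
  by apply: eq_bigr => k _; rewrite scaler_suml; under eq_bigr do rewrite scalerA.
have -> : Lam lam n *: x n = Lam lam n *: x ord0 -
    (\sum_k (\sum_i lam i n * L i k) *: g k + c *: \sum_(k < N.+1 | (k < n)%N) g k).
  rewrite xE scalerBr scaler_sumr; congr (_ - _).
  rewrite scaler_sumr [X in _ = _ + X]big_mkcond -big_split/=.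
  apply: eq_bigr => k _; rewrite scalerA; case: ltnP => [kn|nk].
    by rewrite WE// -scalerDl addrC.
  rewrite ext_eq0// mulr0 scale0r big1 ?scale0r ?addr0// => i _.
  have [ni|inn] := leqP n i; first by case: lamP => -> //; rewrite mul0r.
  by rewrite ext_eq0 ?mulr0// (leq_trans (ltnW inn)).
rewrite LamE// scalerDl !scalerBr.
apply/rowP => k; rewrite !mxE; ring.
Qed.

(** With [G = sum_n g_n], the double sum over [k < n] is half of [|G|^2 - sum_n |g_n|^2], and
    [|c G - e/(N+1)|^2 >= 0] bounds what is left. *)
Lemma residual_bound (d : nat) (g : 'I_N.+1 -> 'rV[R]_d) (e : 'rV[R]_d) :
  (forall n, dot (g n) (g n) <= M ^+ 2) -> dot e e <= D ^+ 2 ->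
  \sum_n dot (g n) (N.+1%:R^-1 *: e - c *: \sum_(k < N.+1 | (k < n)%N) g k)
    <= M * D / Num.sqrt N.+1%:R.
Proof.
move=> gM eD; pose G := \sum_n g n.
set n1 := N.+1%:R : R; set s := Num.sqrt n1.
have n10 : 0 < n1 by rewrite ltr0n.
have s0 : 0 < s by rewrite sqrtr_gt0.
have ss : n1 = s ^+ 2 by rewrite sqr_sqrtr// ltW.
have c0 := step_gt0.
have GG := sym_sum (fun i j => dotC (g i) (g j)).
have GGE : dot G G = \sum_i \sum_j dot (g i) (g j).
  by rewrite dot_suml; under eq_bigr do rewrite dot_sumr.
have gg : \sum_i dot (g i) (g i) <= n1 * M ^+ 2.
  rewrite (le_trans (ler_sum _ (fun i _ => gM i)))// sumr_const card_ord.
  by rewrite /n1 mulr_natl.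
have sq := dot_ge0 (c *: G - n1^-1 *: e).
rewrite !(dotBl, dotBr, dotZl, dotZr) (dotC e) in sq.
have -> : \sum_n dot (g n) (n1^-1 *: e - c *: \sum_(k < N.+1 | (k < n)%N) g k) =
    n1^-1 * dot G e - c * \sum_(n < N.+1) \sum_(k < N.+1 | (k < n)%N) dot (g n) (g k).
  under eq_bigr do rewrite dotBr !dotZr dot_sumr.
  by rewrite sumrB -!mulr_sumr dot_suml.
rewrite -GGE in GG.
set P := \sum_(n < N.+1) _ in GG *.
set Q := \sum_i dot (g i) (g i) in GG gg.
have n1i : 0 < n1^-1 by rewrite invr_gt0.
have cE : c = D / (M * s ^+ 3) by rewrite stepE.
(* The value of [c] balances the two terms: each equals [M * D / s]. *)
have vE : M * D / s = (n1^-1 * n1^-1 * D ^+ 2 / c + c * (n1 * M ^+ 2)) / 2.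
  rewrite cE ss; field.
  by rewrite !gt_eqF.
have eD' : n1^-1 * n1^-1 * dot e e / c <= n1^-1 * n1^-1 * D ^+ 2 / c.
  by rewrite ler_pM2r ?invr_gt0// ler_pM2l// mulr_gt0.
have sq' : 0 <= c * dot G G - 2 * (n1^-1 * dot G e) + n1^-1 * n1^-1 * dot e e / c.
  rewrite -(pmulr_rge0 _ c0); apply: le_trans sq _.
  rewrite le_eqVlt; apply/orP; left; apply/eqP; field.
  by rewrite !gt_eqF.
have cgg : c * Q <= c * (n1 * M ^+ 2) by rewrite ler_pM2l.
rewrite vE; move: eD' sq' cgg; rewrite GG.
move: (n1^-1 * n1^-1 * dot e e / c) (n1^-1 * n1^-1 * D ^+ 2 / c)
  (n1^-1 * dot G e) (c * (n1 * _)) => a b t w.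
by clear; move=> *; lra.
Qed.
End upper_bound.

(** The subgradient inequality is tested at [x + g] against the Lipschitz bound. *)
Lemma subgradient_bound (R : realType) (M : R) (d : nat) (f : 'rV[R]_d -> R)
    (x g : 'rV[R]_d) :
  0 <= M -> (forall x y, `|f x - f y| <= M * norm2 (x - y)) ->
  subgradient f x g -> dot g g <= M ^+ 2.
Proof.
move=> M0 fM /(_ (x + g)); have xg : x + g - x = g by rewrite addrAC subrr add0r.
have := le_trans (ler_norm _) (fM (x + g) x); rewrite xg => fxg gfx.
have : dot g g <= M * norm2 g by apply: le_trans fxg; rewrite lerBrDl.
rewrite -norm2_sqr expr2; have [->|g0] := eqVneq (norm2 g) 0.
  by rewrite mul0r exprn_ge0.
have gg : 0 < norm2 g by rewrite lt0r g0 norm2_ge0.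
by rewrite ler_pM2r// => gM; rewrite -expr2 ler_sqr ?nnegrE// ltW.
Qed.

Lemma aligned_vector (R : realType) (M : R) (d : nat) (y : 'rV[R]_d) :
  0 <= M -> exists2 g, dot g g <= M ^+ 2 & dot g y = M * norm2 y.
Proof.
move=> M0; have [y0|y0] := eqVneq (norm2 y) 0.
  exists 0; first by rewrite dot0r exprn_ge0.
  by rewrite dotC dot0r y0 mulr0.
exists ((M / norm2 y) *: y); rewrite ?dotZl ?dotZr -norm2_sqr.
  by rewrite le_eqVlt; apply/orP; left; apply/eqP; field.
by field.
Qed.

(* A trajectory carries no subgradient at its last point [x_N]; there, [x_N] is
   compared with the convex combination [z] of the other points by Jensen and
   the Lipschitz bound, and the role of [g_N] is played by a vector of norm at
   most [M] aligned with [x_N - z]. *)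
Lemma final_gap_le (R : realType) (M D : R) (N : nat) (lam : 'M[R]_N.+1)
    (W : 'M[R]_N) :
  0 < M -> 0 < D -> polyhedron R N lam -> is_trig_mx W ->
  (forall n j : 'I_N.+1, (j < n)%N ->
    Lam lam n * ext W n j = step M D N + \sum_i lam i n * ext W i j) ->
  ubound (final_gaps M D W) (M * D / Num.sqrt N.+1%:R).
Proof.
move=> M0 D0 lamP tW WE _ [d [f [x [g0 [xs [[cf lf [xs' [mxs' dxs']]] [sg tr] mxs ->]]]]]].
(* The minimizer in the gap may differ from the one within distance [D]; only their values agree. *)
have fxs : f xs = f xs' by apply/eqP; rewrite eq_le mxs mxs'.
rewrite {}fxs {xs mxs}; set n1i : R := N.+1%:R^-1.
have n1i0 : 0 <= n1i by rewrite invr_ge0.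
pose y n := Lam lam n *: x n - \sum_i lam i n *: x i - n1i *: xs'.
have [gN gNM gNy] := @aligned_vector R M d (y ord_max) (ltW M0).
pose g k := if unlift ord_max k is Some i then g0 i else gN.
have gE i : g (widen_ord (leqnSn N) i) = g0 i by rewrite /g widen_lift liftK.
have gmax : g ord_max = gN by rewrite /g unlift_none.
have xE n : x n = x ord0 - \sum_k ext W n k *: g k.
  move: n; apply/(trajectory_ext x g tW) => r; rewrite tr; congr (_ - _).
  by apply: eq_bigr => i _; rewrite gE.
have gM n : dot (g n) (g n) <= M ^+ 2.
  case: (unliftP ord_max n) => [k ->|->]; last by rewrite gmax.
  rewrite -widen_lift gE; exact: subgradient_bound (ltW M0) lf (sg k).
have lam0 i j : 0 <= lam i j by exact: polyhedron_ge0.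
have key n : Lam lam n * f (x n) <=
    \sum_i lam i n * f (x i) + n1i * f xs' + dot (g n) (y n).
  case: (unliftP ord_max n) => [k ->|->].
    rewrite -widen_lift gE; set m := widen_ord _ k.
    have -> : dot (g0 k) (y m) = n1i * dot (g0 k) (x m - xs') +
        \sum_i lam i m * dot (g0 k) (x m - x i).
      rewrite /y !dotBr dot_sumr !dotZr LamE// mulrDl mulrBr.
      under [X in _ = _ + X]eq_bigr do rewrite dotBr mulrBr.
      under [X in _ - X - _ = _]eq_bigr do rewrite dotZr.
      by rewrite sumrB -mulr_suml -/n1i; ring.
    have sgi z : f (x m) <= f z + dot (g0 k) (x m - z).
      by have := sg k z; rewrite -/m -opprB dotNr lerBlDr.
    have h1 := ler_wpM2l n1i0 (sgi xs').
    have h2 : (\sum_i lam i m) * f (x m) <= \sum_i lam i m * f (x i) +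
        \sum_i lam i m * dot (g0 k) (x m - x i).
      rewrite mulr_suml -big_split/= ler_sum// => i _.
      by rewrite -mulrDr ler_wpM2l.
    by rewrite LamE// mulrDl -/n1i; clear -h1 h2; lra.
  have LN : Lam lam ord_max = 1 :> R.
    have := Lam_flow lamP ord_max; rewrite eqxx big1 ?subr0// => i _.
    by case: lamP => -> //; rewrite -ltnS.
  (* [None] stands for the minimizer, whose weight [1/(N+1)] completes the weights [lam i N] to
     total 1. *)
  pose a (o : option 'I_N.+1) := if o is Some i then lam i ord_max else n1i.
  pose p (o : option 'I_N.+1) := if o is Some i then x i else xs'.
  have a0 o : 0 <= a o by case: o => [i|] /=.
  have [z zE fz] := @convex_jensen R d f _ (None :: map Some (index_enum 'I_N.+1)) a p cf a0.
  move: zE fz; rewrite !big_cons !big_map/= -/n1i -LamE// LN scale1r mul1r.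
  move=> zE fz; have yE : y ord_max = x ord_max - z.
    by rewrite /y LN scale1r -zE opprD addrA addrAC.
  rewrite mul1r gmax gNy yE.
  have := le_trans (ler_norm _) (lf (x ord_max) z).
  rewrite lerBlDl => /le_trans; apply.
  by rewrite lerD2r (le_trans fz)// addrC.
(* On summing [key] over [n], every [f (x_n)] with [n < N] cancels by [Lam_flow], and [f (x_N)]
   keeps coefficient 1. *)
have tot : f (x ord_max) - f xs' <= \sum_n dot (g n) (y n).
  have := ler_sum (index_enum 'I_N.+1) (fun n (_ : true) => key n).
  rewrite !big_split/= exchange_big/= sumr_const card_ord.
  have -> : n1i * f xs' *+ N.+1 = f xs'.
    by rewrite -[LHS]mulr_natl mulrA divff ?mul1r// pnatr_eq0.
  have : \sum_n Lam lam n * f (x n) - \sum_n \sum_i lam n i * f (x n) =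
      f (x ord_max).
    rewrite -sumrB (bigD1 ord_max)//= [X in _ + X]big1 => [|n nN].
      by rewrite addr0 -mulr_suml -mulrBl Lam_flow// eqxx mul1r.
    by rewrite -mulr_suml -mulrBl Lam_flow// (negbTE nN) mul0r.
  by move=> <-; clear; lra.
apply: le_trans tot _.
under eq_bigr do rewrite /y (trajectory_residual lamP tW WE xs' _ xE).
apply: (residual_bound M0 D0 gM); rewrite -norm2_le//; exact: ltW.
Qed.

(** * Necessity: multipliers of an optimal method *)

Lemma optimal_entry_gt0 (R : realType) (M D : R) (N : nat) (W : 'M[R]_N)
    (i j : 'I_N.+1) : 0 < M -> 0 < D -> is_trig_mx W ->
  ubound (final_gaps M D W) (M * D / Num.sqrt N.+1%:R) ->
  (j < i)%N -> 0 < ext W i j.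
Proof.
move=> M0 D0 tW ub ji; rewrite ltNge; apply/negP => W0.
have N0 : (0 < N)%N by rewrite (leq_ltn_trans (leq0n j))// (leq_trans ji)// -ltnS.
have [gap /ub gapub] := resisting_instance (ltW M0) (ltW D0) tW ji W0.
apply/negP; rewrite -ltNge; apply: le_lt_trans gapub _.
by rewrite ltr_pM2l ?mulr_gt0// ltf_pV2 ?posrE ?sqrtr_gt0 ?ltr0n// ltr_sqrt ?ltr0n// ltr_nat.
Qed.

(** Farkas' lemma is applied on the dual side: the vectors are the certificates [(y, u)], the
    functionals [a] are indexed by the entries of [lam], and the coefficients of [b] in terms of the
    [a] are the multipliers sought. *)
Lemma optimal_multipliers (R : realType) (M D : R) (N : nat) (W : 'M[R]_N) :
  0 < M -> 0 < D -> is_trig_mx W ->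
  ubound (final_gaps M D W) (M * D / Num.sqrt N.+1%:R) ->
  exists2 lam, polyhedron R N lam & W = W_of M D lam.
Proof.
move=> M0 D0 tW ub; pose L := ext W; pose c := step M D N.
set v := M * D / _ in ub; pose n1 : R := N.+1%:R.
have n10 : 0 < n1 by rewrite ltr0n.
have s0 : 0 < Num.sqrt n1 by rewrite sqrtr_gt0.
have ss : n1 = Num.sqrt n1 ^+ 2 by rewrite sqr_sqrtr// ltW.
pose V : lmodType R := ('M[R]_N.+1 * 'rV[R]_N.+1)%type.
pose a (t : 'I_N.+1 * 'I_N.+1) (z : V) : R := let: (i, n) := t in
  if (i < n)%N then
    - (\sum_(j < N.+1 | (j < n)%N) z.1 n j * (L n j - L i j) + z.2 0 i - z.2 0 n)
  else 0.
pose b (z : V) : R :=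
  - (\sum_(n < N.+1) \sum_(j < N.+1 | (j < n)%N) z.1 n j * (c - L n j / n1)
     + (\sum_j z.2 0 j) / n1 - z.2 0 ord_max).
have DZ m p (k : R) (A B : 'M[R]_(m, p)) i j : (k *: A + B) i j = k * A i j + B i j.
  by rewrite !mxE.
have la t : scalar (a t).
  case: t => i n k [y u] [y' u'] /=; case: ifP => _; last by rewrite mulr0 addr0.
  rewrite !DZ; under eq_bigr do rewrite DZ mulrDl -mulrA.
  by rewrite big_split/= -mulr_sumr; ring.
have lb : scalar b.
  move=> k [y u] [y' u'] /=; rewrite /b/= !DZ.
  under eq_bigr do (under eq_bigr do rewrite DZ mulrDl -mulrA;
    rewrite big_split/= -mulr_sumr).
  under [X in _ + X / _]eq_bigr do rewrite DZ.
  by rewrite !big_split/= -!mulr_sumr; ring.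
have ab z : {in index_enum ('I_N.+1 * 'I_N.+1)%type, forall t, a t z <= 0} -> b z <= 0.
  move=> az; rewrite leNgt; apply/negP => bz.
  pose y := z.1; pose u := z.2 0.
  (* Only the entries of [y] below the diagonal enter [a] and [b]. They are reflected to a symmetric
     matrix with zero diagonal, so that the perturbed Gram matrix keeps the norms equal to [M]. *)
  pose Y : 'M[R]_N.+1 := \matrix_(i, j)
    if (j < i)%N then y i j else if (i < j)%N then y j i else 0.
  have YE i j : Y i j = if (j < i)%N then y i j else if (i < j)%N then y j i else 0.
    by rewrite mxE.
  have Ysum (F : 'I_N.+1 -> R) (n : 'I_N.+1) :
      (forall j : 'I_N.+1, (n <= j)%N -> F j = 0) ->
      \sum_j Y n j * F j = \sum_(j < N.+1 | (j < n)%N) y n j * F j.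
    move=> F0; rewrite [RHS]big_mkcond; apply: eq_bigr => j _; rewrite YE.
    by case: ltnP => // nj; rewrite F0// mulr0.
  have L0 (n j : 'I_N.+1) : (n <= j)%N -> L n j = 0 by exact: ext_eq0.
  pose P := \sum_(n < N.+1) \sum_(j < N.+1 | (j < n)%N) y n j.
  pose Q := \sum_(n < N.+1) \sum_(j < N.+1 | (j < n)%N) y n j * L n j.
  have Ysym i j : Y i j = Y j i by rewrite !YE; case: ltngtP.
  have Ydiag i : Y i i = 0 by rewrite YE ltnn.
  have YP : \sum_i \sum_j Y i j = 2 * P.
    rewrite sym_sum// big1 ?add0r//; congr (_ * _); apply: eq_bigr => n _.
    by apply: eq_bigr => j jn; rewrite YE jn.
  have YQ : \sum_i \sum_j Y i j * L i j = Q.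
    by apply: eq_bigr => n _; rewrite Ysum// => j; exact: L0.
  have bE : b z = - (c * P - Q / n1 + (\sum_j u j) / n1 - u ord_max).
    rewrite /b; congr (- (_ + _ - _)); rewrite /P /Q mulr_sumr mulr_suml -sumrB.
    apply: eq_bigr => n _; rewrite mulr_sumr mulr_suml -sumrB.
    by apply: eq_bigr => j _; rewrite /y; ring.
  have v0 : 0 < v by rewrite divr_gt0// mulr_gt0.
  have vE : n1 * v ^+ 2 = M ^+ 2 * D ^+ 2.
    by rewrite ss /v; field; rewrite gt_eqF.
  have vc : v / M ^+ 2 = n1 * c.
    by rewrite /c stepE -/n1 /v -/n1 ss sqrtr_sqr gtr0_norm//; field; rewrite !gt_eqF.
  have [||gap /ub gapv] := @perturbed_instance R M D v N W Y u M0 (ltW D0) v0 vE tW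
      Ysym Ydiag (fun i j => optimal_entry_gt0 M0 D0 tW ub).
  - move=> i n inn; have := az (i, n) (mem_index_enum _).
    rewrite /a inn oppr_le0 Ysum// => j nj.
    by rewrite -/L !L0 ?subrr// (leq_trans (ltnW inn)).
  - rewrite YP -/L YQ vc.
    suff -> : n1 * c / 2 * (2 * P) - Q + \sum_i u i - n1 * u ord_max = - (n1 * b z).
      by rewrite oppr_lt0 mulr_gt0.
    by rewrite bE; field; rewrite gt_eqF.
  by rewrite ltNge gapv.
have [l l0 lE] := farkas (index_enum_uniq _) la lb ab.
pose lam : 'M[R]_N.+1 := \matrix_(i, n) if (i < n)%N then l (i, n) else 0.
have lamE z : b z = \sum_i \sum_n lam i n * a (i, n) z.
  rewrite lE pair_bigA/=; apply: eq_bigr => -[i n] _ /=; rewrite mxE.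
  by case: ifP => // _; rewrite mulr0 mul0r.
have lam0 (i n : 'I_N.+1) : ~~ (i < n)%N -> lam i n = 0.
  by rewrite mxE => /negbTE ->.
have lamP : polyhedron R N lam.
  split=> [i j ji|i j ij|j jN]; rewrite ?mxE.
  - by rewrite ltnNge ji.
  - by rewrite ij.
  rewrite big_mkcond [X in _ - X]big_mkcond/=.
  rewrite (eq_bigr (lam j)) => [|i _]; last by case: ifPn => // /lam0 ->.
  rewrite [X in _ - X](eq_bigr (lam ^~ j)) => [|i _]; last first.
    by case: ifPn => // /lam0 ->.
  (* Evaluating the identity on the unit vector of [u_j] gives the flow equation at [j]. *)
  have := lamE (0, delta_mx 0 j).
  rewrite /b/= big1 => [|n _]; last by rewrite big1// => k _; rewrite mxE mul0r.
  rewrite mxE [ord_max == j]eq_sym [j == _](_ : _ = false); last first.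
    by apply/eqP => jE; rewrite jE ltnn in jN.
  rewrite add0r andbF subr0 (bigD1 j)//= big1 => [|k /negbTE kj]; last first.
    by rewrite mxE kj andbF.
  rewrite mxE !eqxx addr0 div1r => bE; apply/oppr_inj; rewrite bE.
  transitivity (\sum_i \sum_n ((n == j)%:R * lam i n - (i == j)%:R * lam i n)).
    under [RHS]eq_bigr do rewrite sumrB.
    rewrite sumrB opprB; congr (_ - _).
      apply: eq_bigr => i _; rewrite (bigD1 j)//= eqxx mul1r big1 ?addr0// => n.
      by move=> /negbTE ->; rewrite mul0r.
    rewrite [RHS](bigD1 j)//= [X in _ = _ + X]big1 => [|i /negbTE ij].
      by rewrite addr0 eqxx; apply: eq_bigr => n _; rewrite mul1r.
    by rewrite big1// => n _; rewrite ij mul0r.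
  apply: eq_bigr => i _; apply: eq_bigr => n _.
  have [inn|/lam0 ->] := boolP (i < n)%N; last by rewrite !mulr0 subrr ?mul0r.
  rewrite big1 => [|k _]; last by rewrite mxE mul0r.
  have dE k : delta_mx 0 j (0 : 'I_1) k = (k == j)%:R :> R by rewrite mxE.
  by rewrite !dE; ring.
exists lam => //; apply/(W_ofP M D lamP tW) => n j jn.
(* On the unit vector of [y_{n,j}] the same identity gives the recursion for the entry [(n, j)]. *)
have := lamE (delta_mx n j, 0).
have deltaE (m : 'I_N.+1) (F : 'I_N.+1 -> R) :
    \sum_(k < N.+1 | (k < m)%N) delta_mx n j m k * F k = (m == n)%:R * F j.
  rewrite big_mkcond (bigD1 j)//= big1 ?addr0 => [|k /negbTE kj].
    rewrite mxE eqxx andbT; case: eqP => [->|_]; first by rewrite jn.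
    by rewrite mul0r if_same.
  by rewrite mxE kj andbF mul0r if_same.
rewrite /b/=; under eq_bigr do rewrite deltaE.
rewrite (bigD1 n)//= eqxx mul1r big1 => [|m /negbTE ->]; last by rewrite mul0r.
rewrite big1 => [|k _]; last by rewrite mxE.
have zE k : (0 : 'rV[R]_N.+1) 0 k = 0 by rewrite mxE.
rewrite mul0r zE !addr0 subr0 => bE.
have : c - L n j / n1 = \sum_i lam i n * (L n j - L i j).
  apply/oppr_inj; rewrite bE -sumrN; apply: eq_bigr => i _.
  rewrite (bigD1 n)//= [X in _ + X]big1 => [|m /negbTE mn].
    have [inn|/lam0 ->] := boolP (i < n)%N; last by rewrite !mul0r oppr0 addr0.
    by rewrite deltaE eqxx mul1r !zE; ring.
  by case: ifP => _; rewrite ?mulr0// deltaE mn mul0r !zE; ring.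
rewrite -/L -/c LamE// mulrDl mulr_suml.
under [X in _ = X -> _]eq_bigr do rewrite mulrBr.
rewrite sumrB => cE; have -> : c = c - L n j / n1 + L n j / n1 by rewrite subrK.
by rewrite cE -/n1; ring.
Qed.

Theorem theorem1p3 (R : realType) (M D : R) (N : nat) (hM : 0 < M) (hD : 0 < D)
    (hN : (1 <= N)%N) :
  optimal_methods M D N = [set W_of M D lam | lam in polyhedron R N].
Proof.
apply/seteqP; split=> [W [tW [_ ub]]|_ [lam lamP <-]].
  by have [lam lamP ->] := optimal_multipliers hM hD tW ub; exists lam.
have tW := W_of_trig M D lam.
have WE := (W_ofP M D lamP tW).1 erefl.
have ub := final_gap_le hM hD lamP tW WE.
split=> //; split=> //.
(* With [kappa] the identity, every answer is a new coordinate among [N+1]; the gap is then at least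
   the upper bound, hence equal to it, and the maximum is attained. *)
have [i l|i|gap gapP vgap] :=
    @coordinate_instance R M D N (W_of M D lam) N.+1 id (ltW hM) (ltW hD) tW.
- by rewrite /= !big_pred1_eq ext_eq0// (ext_ge0 hM hD lamP).
- by rewrite /= big_pred1_eq ext_eq0.
by rewrite (_ : M * D / _ = gap)//; apply/eqP; rewrite eq_le vgap ub.
Qed.
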